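(* Let $H$ be a coalgebra with an element $1_H$ such that $\Delta(1_H)=1_H\otimes 1_H$, and let $A$, $B$ be two algebras. Let $G: H\otimes H\to A\otimes H$, $R: H\otimes A\to A\otimes H$, $T: B\otimes H\to H\otimes B$ and $\tau: H\otimes H\to B$ be linear maps such that, for all $a,a'\in A$, $x\in H$, $b,b'\in B$: (LB1) $a_R\otimes (1_H)_R=a\otimes 1_H$ and $(1_A)_R\otimes x_R=1_A\otimes x$; (LB2) $(aa')_R\otimes x_R=a_Ra'_r\otimes x_{Rr}$; (LB3) $x^G\otimes (1_H)_G=(1_H)^G\otimes x_G=1_A\otimes x$; (RB1) $(1_H)_T\otimes b_T=1_H\otimes b$ and $x_T\otimes (1_B)_T=x\otimes 1_B$; (RB2) $x_T\otimes (bb')_T=x_{Tt}\otimes b_tb'_T$; (RTC2) $\tau(x,1_H)=\tau(1_H,x)=\varepsilon(x)1_B$. Then the vector space $A\otimes H\otimes B$ is an associative algebra with unit $1_A\otimes 1_H\otimes 1_B$ and multiplication $$(a\otimes x\otimes b)(a'\otimes x'\otimes b')=a\,a'_R\,{x_{R1}}^{G}\otimes x'_{T1G}\otimes \tau(x_{R2},x'_{T2})\,b_T\,b'$$ if and only if the following conditions hold for all $a\in A$, $x,x',x''\in H$, $b\in B$: (BT1) ${x_1}^{G}\,{x'_{1G1}}^{g}\otimes x''_{T1g}\otimes \tau(x'_{1G2},x''_{T2})\,{\tau(x_2,x'_2)}_{T}={({x'_1}^{G})}_{R}\,{x_{R1}}^{g}\otimes x''_{1G1g}\otimes \tau(x_{R2},x''_{1G2})\,\tau(x'_2,x''_2)$;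 (BT2) $a_{Rr}\,{x_{r1}}^{G}\otimes x'_{R1G}\otimes \tau(x_{r2},x'_{R2})={x_1}^{G}\,a_R\otimes x'_{1GR}\otimes \tau(x_2,x'_2)$; (BT3) ${x_1}^{G}\otimes x'_{1GT}\otimes b_T\,\tau(x_2,x'_2)={x_{T1}}^{G}\otimes x'_{t1G}\otimes \tau(x_{T2},x'_{t2})\,b_{Tt}$; (BT4) $a_R\otimes x_{RT}\otimes b_T=a_R\otimes x_{TR}\otimes b_T$.
   Context: Everything is over a field $K$; algebras are associative and unital. Sweedler notation: $\Delta(x)=x_1\otimes x_2$, and $\varepsilon$ is the counit of $H$. Write (with summation understood) $G(x\otimes x')=x^G\otimes x'_G\in A\otimes H$, $R(x\otimes a)=a_R\otimes x_R\in A\otimes H$, $T(b\otimes x)=x_T\otimes b_T\in H\otimes B$. The lower-case letters $g$, $r$, $t$ denote further independent applications of the same maps $G$, $R$, $T$. Decorations on a symbol are read left to right in order of application: e.g. $x_{R1}\otimes x_{R2}=\Delta(x_R)$, $x_{Rr}=(x_R)_r$, $a_{Rr}=(a_R)_r$, $x'_{1G1}\otimes x'_{1G2}=\Delta((x'_1)_G)$, $x'_{T1G}=((x'_T)_1)_G$, where equal letters in one expression belong to the same application of the map. For instance, the multiplication applies $R$ to $x\otimes a'$, $T$ to $b\otimes x'$, then comultiplies $x_R$ and $x'_T$, applies $G$ to $x_{R1}\otimes x'_{T1}$ and $\tau$ to $x_{R2}\otimes x'_{T2}$. Likewise ${\tau(x_2,x'_2)}_T$ together with $x''_T$ means $T$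 applied to $\tau(x_2,x'_2)\otimes x''$, and ${({x'_1}^G)}_R$ together with $x_R$ means $R$ applied to $x\otimes {x'_1}^G$. *)

(* Defs.v *)
From HB Require Import structures.
From mathcomp Require Import all_boot all_algebra.
From mathcomp Require Import generic_quotient ring_quotient.
From mathcomp Require Import boolp.
From mathcomp Require Import freeg.

Set Implicit Arguments.
Unset Strict Implicit.
Unset Printing Implicit Defensive.

Import GRing.Theory.

Local Open Scope ring_scope.
Local Open Scope quotient_scope.

Reserved Notation "v ⊗ w" (at level 45, left associativity).
Reserved Notation "V ⊗[ K ] W" (at level 45, left associativity,
  format "V  ⊗[ K ]  W").
Reserved Notation "a ∙ b" (at level 40, left associativity).
Reserved Notation "\sw_ ( x ⊗ y <- t ) e"
  (at level 46, x name, y name, t at level 200, e at level 46,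
   format "'[' \sw_ ( x  ⊗  y  <-  t ) '/'  e ']'").

Definition is_bilinear (K : fieldType) (U V W : lmodType K)
    (f : U -> V -> W) : Prop :=
  bilinear_for *:%R *:%R f.

(* The tensor product V ⊗ W: the free K-module on V * W modulo the subspace
   generated by the bilinearity relations. *)
Section Tensor.
Variables (K : fieldType) (V W : lmodType K).

Implicit Types (x y : {freeg (V * W) / K}) (v : V) (w : W) (c : K).

Inductive tensor_rel : {freeg (V * W) / K} -> Prop :=
| tensor_rel0 : tensor_rel 0
| tensor_relP c x y : tensor_rel x -> tensor_rel y -> tensor_rel (c *: x + y)
| tensor_rell c v v' w :
    tensor_rel (<< (c *: v + v', w) >> - c *: << (v, w) >> - << (v', w) >>)
| tensor_relr c v w w' :
    tensor_rel (<< (v, c *: w + w') >> - c *: << (v, w) >> - << (v, w') >>).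

Definition tensor_ker : {pred {freeg (V * W) / K}} :=
  [pred x | `[< tensor_rel x >]].

Lemma tensor_kerP x : reflect (tensor_rel x) (x \in tensor_ker).
Proof. exact: asboolP. Qed.

Lemma tensor_ker_submod : submod_closed tensor_ker.
Proof.
split; first exact/tensor_kerP/tensor_rel0.
by move=> c x y /tensor_kerP hx /tensor_kerP hy; exact/tensor_kerP/tensor_relP.
Qed.

HB.instance Definition _ :=
  GRing.isSubmodClosed.Build K {freeg (V * W) / K} tensor_ker tensor_ker_submod.

Definition tensor : Type := Quotient.quot tensor_ker.

HB.instance Definition _ := GRing.Zmodule.on tensor.
HB.instance Definition _ := Quotient.on tensor.

Definition tscale c (t : tensor) : tensor := \pi_tensor (c *: repr t).

Lemma tensor_piD x y : \pi_tensor (x + y) = \pi_tensor x + \pi_tensor y.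
Proof. exact: (raddfD (\pi_(Quotient.quot tensor_ker))). Qed.

Lemma tensor_piP x y : reflect (\pi_tensor x = \pi_tensor y)
  (x - y \in tensor_ker).
Proof. by rewrite Quotient.idealrBE; exact: eqP. Qed.

Lemma tscale_pi c x : tscale c (\pi_tensor x) = \pi_tensor (c *: x).
Proof.
apply/tensor_piP; rewrite -scalerBr; apply: rpredZ.
by apply/tensor_piP; rewrite reprK.
Qed.

Lemma tscaleA a b t : tscale a (tscale b t) = tscale (a * b) t.
Proof. by rewrite {2}/tscale tscale_pi scalerA. Qed.

Lemma tscale1 : left_id 1 tscale.
Proof. by move=> t; rewrite /tscale scale1r reprK. Qed.

Lemma tscaleDr : right_distributive tscale +%R.
Proof.
move=> c t u; rewrite -[t]reprK -[u]reprK -tensor_piD !tscale_pi.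
by rewrite scalerDr tensor_piD.
Qed.

Lemma tscaleDl t : {morph tscale^~ t : a b / a + b}.
Proof. by move=> a b; rewrite /tscale scalerDl tensor_piD. Qed.

HB.instance Definition _ := GRing.Zmodule_isLmodule.Build K tensor
  tscaleA tscale1 tscaleDr tscaleDl.

Definition tens v w : tensor := \pi_tensor << (v, w) >>.

End Tensor.

Notation "V ⊗[ K ] W" := (@tensor K V W) : type_scope.
Notation "V ⊗[ K ] W" := (@tensor K V W) : ring_scope.
Notation "v ⊗ w" := (tens v w) : ring_scope.

(* When f is bilinear, tlift f is the linear map sending v ⊗ w to f v w (see
   tliftE and tlift_linear below), so that \sw_(x ⊗ y <- t) e renders Sweedler's
   implicit summation whenever e is bilinear in x and y. *)
Definition tlift (K : fieldType) (V W U : lmodType K) (f : V -> W -> U)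
    (t : V ⊗[K] W) : U :=
  fglift (fun p : V * W => f p.1 p.2) (repr t).

Notation "\sw_ ( x ⊗ y <- t ) e" := (tlift (fun x y => e) t) : ring_scope.

Section TensorTheory.
Variables (K : fieldType) (V W : lmodType K).

Lemma pi_tensor_linear : linear (\pi_(V ⊗[K] W) : {freeg (V * W) / K} -> V ⊗[K] W).
Proof. by move=> c x y; rewrite tensor_piD -tscale_pi. Qed.

Lemma tens_bilinear : is_bilinear (@tens K V W).
Proof.
split=> [w c v v' | v c w w'].
- transitivity (\pi_(V ⊗[K] W) (c *: << (v, w) >> + << (v', w) >>)).
    by apply/tensor_piP/tensor_kerP; rewrite opprD addrA; exact: tensor_rell.
  exact: pi_tensor_linear.
- transitivity (\pi_(V ⊗[K] W) (c *: << (v, w) >> + << (v, w') >>)).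
    by apply/tensor_piP/tensor_kerP; rewrite opprD addrA; exact: tensor_relr.
  exact: pi_tensor_linear.
Qed.

Lemma tensor_ind (P : V ⊗[K] W -> Prop) :
    P 0 -> (forall c v w t, P t -> P (c *: (v ⊗ w) + t)) ->
  forall t, P t.
Proof.
move=> P0 PD t; rewrite -[t]reprK -(freeg_sumE (repr t)).
have pi0 : \pi_(V ⊗[K] W) 0 = 0.
  by rewrite -[in LHS](subrr 0) -scaleN1r addrC pi_tensor_linear scaleN1r addNr.
have piD1 c p x :
    \pi_(V ⊗[K] W) (<< c *g p >> + x) = c *: (p.1 ⊗ p.2) + \pi_(V ⊗[K] W) x.
  suff -> : << c *g p >> = c *: << (p.1, p.2) >>.
    by rewrite pi_tensor_linear.
  by apply/eqP/freeg_eqP => q; rewrite coeffZ !coeffU mul1r; case: (p).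
elim: (dom _) => [|p s IHs]; first by rewrite big_nil pi0.
by rewrite big_cons piD1; exact: PD.
Qed.

Variables (U : lmodType K) (f : V -> W -> U).
Hypothesis f_bilin : is_bilinear f.

Let F (p : V * W) := f p.1 p.2.

Let fglift_linear : linear (fglift F).
Proof.
move=> c x y; have liftB := lift_is_additive F.
have lift0 : fglift F 0 = 0 by rewrite -(subrr 0) liftB subrr.
have liftD a b : fglift F (a + b) = fglift F a + fglift F b.
  by rewrite -{1}[b]opprK -[- b]sub0r liftB liftB lift0 sub0r opprK.
rewrite liftD; congr (_ + _).
have lift_sum (a : K -> K) : fglift F (\sum_(p <- dom x) << a (coeff p x) *g p >>)
    = \sum_(p <- dom x) a (coeff p x) *: F p.
  elim: (dom x) => [|p s IHs]; first by rewrite !big_nil lift0.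
  by rewrite !big_cons liftD IHs liftU.
rewrite -[in RHS](freeg_sumE x) (lift_sum id) scaler_sumr.
rewrite [LHS](lift_sum ( *%R c)).
by apply: eq_bigr => p _; rewrite scalerA.
Qed.

Lemma fglift_ker x : x \in @tensor_ker K V W -> fglift F x = 0.
Proof.
have liftB := lift_is_additive F.
have lift0 : fglift F 0 = 0 by rewrite -(subrr 0) liftB subrr.
have liftZ c y : fglift F (c *: y) = c *: fglift F y.
  by rewrite -[c *: y]addr0 fglift_linear lift0 addr0.
move/tensor_kerP; elim=> [|c y z _ IHy _ IHz|c v v' w|c v w w'] //.
- by rewrite fglift_linear IHy IHz scaler0 addr0.
- rewrite !liftB liftZ !liftU !scale1r /F /=.
  by rewrite (f_bilin.1 w c v v') /= -addrA -opprD subrr.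
- rewrite !liftB liftZ !liftU !scale1r /F /=.
  by rewrite (f_bilin.2 v c w w') /= -addrA -opprD subrr.
Qed.

Lemma fglift_repr_pi x : tlift f (\pi_(V ⊗[K] W) x) = fglift F x.
Proof.
apply/eqP; rewrite -subr_eq0 /tlift -(lift_is_additive F).
by apply/eqP/fglift_ker/tensor_piP; rewrite reprK.
Qed.

Lemma tliftE v w : tlift f (v ⊗ w) = f v w.
Proof. by rewrite fglift_repr_pi liftU scale1r. Qed.

Lemma tlift_linear : linear (tlift f).
Proof.
move=> c t u; rewrite -[t]reprK -[u]reprK -pi_tensor_linear.
by rewrite !fglift_repr_pi fglift_linear.
Qed.

End TensorTheory.

(* MathComp's algType excludes the zero ring; to allow zero algebras, a unital
   associative algebra over K is presented as a K-module with explicit product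
   and unit. *)
Definition is_algebra (K : fieldType) (V : lmodType K)
    (mul : V -> V -> V) (one : V) : Prop :=
  [/\ is_bilinear mul, associative mul, left_id one mul & right_id one mul].

HB.mixin Record hasAlgebra (K : fieldType) A of GRing.Lmodule K A := {
  amul : A -> A -> A;
  aone : A;
  amulP : is_algebra amul aone
}.

#[short(type="assocAlgType")]
HB.structure Definition AssocAlg (K : fieldType) :=
  {A of GRing.Lmodule K A & hasAlgebra K A}.

Arguments aone {K} A : rename.

Notation "a ∙ b" := (amul a b) : ring_scope.

Definition is_coalgebra (K : fieldType) (H : lmodType K)
    (Δ : {linear H -> H ⊗[K] H}) (ε : {scalar H}) : Prop :=
  [/\ forall x : H,
        \sw_(x1 ⊗ x2 <- Δ x) \sw_(x11 ⊗ x12 <- Δ x1) x11 ⊗ x12 ⊗ x2 =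
        \sw_(x1 ⊗ x2 <- Δ x) \sw_(x21 ⊗ x22 <- Δ x2) x1 ⊗ x21 ⊗ x22,
      forall x : H, \sw_(x1 ⊗ x2 <- Δ x) ε x1 *: x2 = x &
      forall x : H, \sw_(x1 ⊗ x2 <- Δ x) ε x2 *: x1 = x].

HB.mixin Record hasCoalgebra (K : fieldType) H of GRing.Lmodule K H := {
  comul : {linear H -> H ⊗[K] H};
  counit : {scalar H};
  coalgebraP : is_coalgebra comul counit
}.

#[short(type="coalgType")]
HB.structure Definition Coalgebra (K : fieldType) :=
  {H of GRing.Lmodule K H & hasCoalgebra K H}.

Notation Δ := comul.
Notation ε := counit.

Section Multilinear.
Variable K : fieldType.

Lemma linear_tliftf (P V W U : lmodType K) (f : P -> V -> W -> U) t :
  (forall v w, linear (fun p => f p v w)) -> linear (fun p => tlift (f p) t).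
Proof.
move=> lf c p q; rewrite /tlift /freeg.fglift; unlock.
rewrite /freeg.lift /freeg.prelift /= scaler_sumr -big_split /=.
apply: eq_bigr => i _; rewrite lf scalerDr; congr (_ + _).
by rewrite !scalerA mulrC.
Qed.

Lemma linear_tlift (P V W U : lmodType K) (f : V -> W -> U) (t : P -> V ⊗[K] W) :
  is_bilinear f -> linear t -> linear (fun p => tlift f (t p)).
Proof. by move=> bf lt c p q; rewrite lt tlift_linear. Qed.

Lemma linear_comp (P V U : lmodType K) (f : {linear V -> U}) (t : P -> V) :
  linear t -> linear (fun p => f (t p)).
Proof. by move=> lt c p q; rewrite lt linearP. Qed.

Lemma linear_tensl (P V W : lmodType K) (w : W) (t : P -> V) :
  linear t -> linear (fun p => t p ⊗ w).
Proof. by move=> lt c p q; rewrite lt (tens_bilinear V W).1. Qed.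

Lemma linear_tensr (P V W : lmodType K) (v : V) (t : P -> W) :
  linear t -> linear (fun p => v ⊗ t p).
Proof. by move=> lt c p q; rewrite lt (tens_bilinear V W).2. Qed.

Lemma linear_amull (P : lmodType K) (A : assocAlgType K) (w : A) (t : P -> A) :
  linear t -> linear (fun p => t p ∙ w).
Proof. by have [b _ _ _] := amulP (s:=A); move=> lt c p q; rewrite lt b.1. Qed.

Lemma linear_amulr (P : lmodType K) (A : assocAlgType K) (v : A) (t : P -> A) :
  linear t -> linear (fun p => v ∙ t p).
Proof. by have [b _ _ _] := amulP (s:=A); move=> lt c p q; rewrite lt b.2. Qed.

Lemma linear_id (P : lmodType K) : linear (fun p : P => p).
Proof. by []. Qed.

End Multilinear.

(* Proves is_bilinear and linear goals for bodies built from \sw_, linear maps,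
   ⊗ and ∙ in which every variable occurs once. *)
Ltac multilinear := intros; match goal with
 | |- is_bilinear _ => split; [intro | intro]; cbv beta; multilinear
 | |- @GRing.linear_for _ _ _ _
         (fun x => x) =>
     exact: linear_id
 | |- @GRing.linear_for _ _ _ _
         (fun x => tlift (fun y z => @?f x y z) ?t) =>
     apply: (@linear_tliftf _ _ _ _ _ f); multilinear
 | |- @GRing.linear_for _ _ _ _
         (fun x => tlift ?f (@?t x)) =>
     apply: (@linear_tlift _ _ _ _ _ f t); multilinear
 | |- @GRing.linear_for _ _ _ _
         (fun x => ?v ⊗ (@?t x)) =>
     apply: (@linear_tensr _ _ _ _ v t); multilinear
 | |- @GRing.linear_for _ _ _ _
         (fun x => (@?t x) ⊗ ?v) =>
     apply: (@linear_tensl _ _ _ _ v t); multilinear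
 | |- @GRing.linear_for _ _ _ _
         (fun x => ?v ∙ (@?t x)) =>
     apply: (@linear_amulr _ _ _ v t); multilinear
 | |- @GRing.linear_for _ _ _ _
         (fun x => (@?t x) ∙ ?v) =>
     apply: (@linear_amull _ _ _ v t); multilinear
 | |- @GRing.linear_for _ _ _ _
         (fun x => _ (@?t x)) =>
     apply: (@linear_comp _ _ _ _ _ t); multilinear
 end.

Section BTProduct.
Variables (K : fieldType) (H : coalgType K) (A B : assocAlgType K).
Variables (G : {linear H ⊗[K] H -> A ⊗[K] H}) (R : {linear H ⊗[K] A -> A ⊗[K] H}).
Variables (T : {linear B ⊗[K] H -> H ⊗[K] B}) (τ : {linear H ⊗[K] H -> B}).

Definition bt_mul (u v : A ⊗[K] H ⊗[K] B) : A ⊗[K] H ⊗[K] B :=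
  \sw_(ax ⊗ b <- u) \sw_(a ⊗ x <- ax)
  \sw_(ax' ⊗ b' <- v) \sw_(a' ⊗ x' <- ax')
  \sw_(a'R ⊗ xR <- R (x ⊗ a')) \sw_(x'T ⊗ bT <- T (b ⊗ x'))
  \sw_(xR1 ⊗ xR2 <- Δ xR) \sw_(x'T1 ⊗ x'T2 <- Δ x'T)
  \sw_(xR1G ⊗ x'T1G <- G (xR1 ⊗ x'T1))
    a ∙ a'R ∙ xR1G ⊗ x'T1G ⊗ τ (xR2 ⊗ x'T2) ∙ bT ∙ b'.

Lemma bt_mulE a x b a' x' b' :
  bt_mul (a ⊗ x ⊗ b) (a' ⊗ x' ⊗ b') =
  \sw_(a'R ⊗ xR <- R (x ⊗ a')) \sw_(x'T ⊗ bT <- T (b ⊗ x'))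
  \sw_(xR1 ⊗ xR2 <- Δ xR) \sw_(x'T1 ⊗ x'T2 <- Δ x'T)
  \sw_(xR1G ⊗ x'T1G <- G (xR1 ⊗ x'T1))
    a ∙ a'R ∙ xR1G ⊗ x'T1G ⊗ τ (xR2 ⊗ x'T2) ∙ bT ∙ b'.
Proof.
rewrite /bt_mul tliftE; last by multilinear.
by do 3!(rewrite tliftE; last by multilinear).
Qed.

Lemma bt_mul_bilinear : is_bilinear (bt_mul).
Proof. split; [intro u|intro u]; rewrite /bt_mul; cbv beta; multilinear. Qed.

End BTProduct.

(* Main.v *)
Require Import Defs.
From HB Require Import structures.
From mathcomp Require Import all_boot all_algebra.
From mathcomp Require Import boolp.

(** Write M = A ⊗ H ⊗ B, u ⋆ v for the proposed product, and identify a, x, b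
    with the elements a ⊗ 1 ⊗ 1, 1 ⊗ x ⊗ 1, 1 ⊗ 1 ⊗ b of M.  The four conditions
    say that four kinds of triples associate, and associativity of every other
    triple reduces to these.

    The hypotheses on G, R, T and τ already give, before any of the four
    conditions:
    - 1 ⊗ 1 ⊗ 1 is a unit for ⋆ (mul_unitl, mul_unitr);
    - the image of A lies in the left and middle nuclei and the image of B in the
      middle and right nuclei: the triples (a, u, v), (u, a, v), (u, b, v) and
      (u, v, b) associate for all u and v (nucleusA_l, nucleusA_m, nucleusB_m,
      nucleusB_r).  The middle nuclei express the multiplicativity of R in A and
      of T in B;
    - a ⊗ x ⊗ b = a ⋆ (x ⋆ b), so such products span M (pure_split);
    - elements of B move to the right: b ⋆ x = x_T ⋆ b_T and b ⋆ a = a ⋆ b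
      (mulBH, mulBA).

    In a triple of spanning elements, the nuclei let factors from A and B cross
    the commas.  A factor from A at the left end, or from B at the right end,
    pulls out of the associator; a factor from A elsewhere moves left, and one
    from B moves right past whatever it meets.  So ⋆ is associative as soon as
    the triples (u, x, w) associate for x in H, u in H or B, and w in H or A
    (associates_all).  Computing the two bracketings of such a triple produces the
    two sides of a condition: the four conditions, in order, belong to the triples
    from (H, H, H), (H, H, A), (B, H, H) and (B, H, A). *)

Set Implicit Arguments.
Unset Strict Implicit.
Unset Printing Implicit Defensive.

Import GRing.Theory.

Local Open Scope ring_scope.

(** * Calculus of Sweedler sums *)

Section Sweedler.
Variables (K : fieldType) (V W U : lmodType K).
Implicit Types (f g : V -> W -> U) (t : V ⊗[K] W).

Lemma eq_sw f g t : (forall v w, f v w = g v w) ->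
  \sw_(v ⊗ w <- t) f v w = \sw_(v ⊗ w <- t) g v w.
Proof. by move=> fg; congr tlift; apply/funext => v; apply/funext => w. Qed.

(** A Sweedler sum is a finite linear combination of values of its body, whether or
    not that body is bilinear; hence it commutes with linear maps, and two such sums
    can be interchanged ([sw_swap]). *)
Lemma sw_out (Z : lmodType K) (h : U -> Z) f t : linear h ->
  h (\sw_(v ⊗ w <- t) f v w) = \sw_(v ⊗ w <- t) h (f v w).
Proof.
move=> h_lin; rewrite /tlift /freeg.fglift; unlock.
rewrite /freeg.lift /freeg.prelift.
pose hL := GRing.isLinear.Build K U Z *:%R h h_lin.
pose h' : {linear U -> Z} := HB.pack h hL.
rewrite -[h]/(h' : U -> Z) linear_sum.
by apply: eq_bigr => i _; rewrite linearZ.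
Qed.

(** Pure tensors span, so they test equality of linear maps. *)
Lemma tensor_ext (h k : V ⊗[K] W -> U) : linear h -> linear k ->
  (forall v w, h (v ⊗ w) = k (v ⊗ w)) -> forall t, h t = k t.
Proof.
move=> hl kl hk; elim/tensor_ind => [|c v w t IH]; last by rewrite hl kl hk IH.
have z (l : V ⊗[K] W -> U) : linear l -> l 0 = 0.
  by move=> ll; rewrite -(subrr 0) -scaleN1r addrC ll scaleN1r addNr.
by rewrite !z.
Qed.

End Sweedler.

Lemma sw_swap (K : fieldType) (V W V' W' U : lmodType K)
    (f : V -> W -> V' -> W' -> U) (t : V ⊗[K] W) (t' : V' ⊗[K] W') :
  \sw_(v ⊗ w <- t) \sw_(v' ⊗ w' <- t') f v w v' w' =
  \sw_(v' ⊗ w' <- t') \sw_(v ⊗ w <- t) f v w v' w'.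
Proof.
rewrite /tlift /freeg.fglift; unlock; rewrite /freeg.lift /freeg.prelift.
under eq_bigr do rewrite scaler_sumr.
under [RHS]eq_bigr do rewrite scaler_sumr.
rewrite exchange_big; apply: eq_bigr => i _; apply: eq_bigr => j _.
by rewrite !scalerA mulrC.
Qed.

Lemma sw_sw (K : fieldType) (V W V' W' U : lmodType K) (f : V -> W -> V' ⊗[K] W')
    (t : V ⊗[K] W) (g : V' -> W' -> U) :
  is_bilinear g ->
  \sw_(v' ⊗ w' <- \sw_(v ⊗ w <- t) f v w) g v' w' =
  \sw_(v ⊗ w <- t) \sw_(v' ⊗ w' <- f v w) g v' w'.
Proof. by move=> g_bil; apply: (sw_out (h:=tlift g)); exact: tlift_linear. Qed.

Lemma tensZl (K : fieldType) (V W : lmodType K) c (v : V) (w : W) :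
  (c *: v) ⊗ w = c *: (v ⊗ w).
Proof. exact: (scalable_linear ((tens_bilinear V W).1 w)). Qed.

Lemma tensZr (K : fieldType) (V W : lmodType K) c (v : V) (w : W) :
  v ⊗ (c *: w) = c *: (v ⊗ w).
Proof. exact: (scalable_linear ((tens_bilinear V W).2 v)). Qed.

Lemma amulA (K : fieldType) (C : assocAlgType K) : associative (@amul K C).
Proof. by case: (amulP (s := C)). Qed.

Lemma amul1l (K : fieldType) (C : assocAlgType K) (c : C) : aone C ∙ c = c.
Proof. by case: (amulP (s := C)) => _ _ ->. Qed.

Lemma amul1r (K : fieldType) (C : assocAlgType K) (c : C) : c ∙ aone C = c.
Proof. by case: (amulP (s := C)) => _ _ _ ->. Qed.

Ltac sw_pure := rewrite tliftE; last by multilinear.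

Section BTAlgebra.
Variables (K : fieldType) (H : coalgType K) (A B : assocAlgType K).
Variables (G : {linear H ⊗[K] H -> A ⊗[K] H}) (R : {linear H ⊗[K] A -> A ⊗[K] H}).
Variables (T : {linear B ⊗[K] H -> H ⊗[K] B}) (τ : {linear H ⊗[K] H -> B}).
Local Notation M := (A ⊗[K] H ⊗[K] B).

Lemma triple_ext (U : lmodType K) (h k : M -> U) : linear h -> linear k ->
  (forall a x b, h (a ⊗ x ⊗ b) = k (a ⊗ x ⊗ b)) -> forall m, h m = k m.
Proof.
move=> h_lin k_lin hk; apply: tensor_ext => // p b; move: p.
apply: tensor_ext => [||a x //].
- by move=> c u v /=; rewrite (tens_bilinear _ _).1 h_lin.
- by move=> c u v /=; rewrite (tens_bilinear _ _).1 k_lin.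
Qed.

(** * The product through its values on H *)

(** The maps [mul], [biact] and [hprod] are bundled as linear maps on tensor
    products, rather than as curried functions, so that the linearity of an
    expression built from them is read off its syntax. *)
Definition mul (t : M ⊗[K] M) : M := \sw_(u ⊗ v <- t) bt_mul G R T τ u v.

Fact mul_linear : linear mul.
Proof. exact: tlift_linear (bt_mul_bilinear G R T τ). Qed.

HB.instance Definition _ :=
  GRing.isLinear.Build K (M ⊗[K] M) M *:%R mul mul_linear.

Local Notation "u ⋆ v" := (mul (u ⊗ v)) (at level 40, left associativity).

Lemma mul_bt u v : u ⋆ v = bt_mul G R T τ u v.
Proof. by rewrite /mul tliftE //; exact: bt_mul_bilinear. Qed.

Definition biact (t : A ⊗[K] M ⊗[K] B) : M :=
  \sw_(am ⊗ b' <- t) \sw_(a ⊗ m <- am) \sw_(px ⊗ b <- m) \sw_(p ⊗ x <- px)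
    a ∙ p ⊗ x ⊗ b ∙ b'.

Fact biact_linear : linear biact.
Proof. rewrite /biact; multilinear. Qed.

HB.instance Definition _ :=
  GRing.isLinear.Build K _ M *:%R biact biact_linear.

Lemma biactE a p x b b' : biact (a ⊗ (p ⊗ x ⊗ b) ⊗ b') = a ∙ p ⊗ x ⊗ b ∙ b'.
Proof. by rewrite /biact; do 4 sw_pure. Qed.

Lemma biact_biact a a' m b b' :
  biact (a ⊗ biact (a' ⊗ m ⊗ b') ⊗ b) = biact (a ∙ a' ⊗ m ⊗ b' ∙ b).
Proof.
by move: m; apply: triple_ext => [||p x q]; rewrite ?biactE ?amulA //; multilinear.
Qed.

Lemma biact1 m : biact (aone A ⊗ m ⊗ aone B) = m.
Proof.
by move: m; apply: triple_ext => [||p x q]; rewrite ?biactE ?amul1l ?amul1r //;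
  multilinear.
Qed.

(** The product in M of two elements of H; see [mulHH]. *)
Definition hprod (t : H ⊗[K] H) : M :=
  \sw_(x ⊗ x' <- t)
  \sw_(x1 ⊗ x2 <- Δ x) \sw_(x'1 ⊗ x'2 <- Δ x')
  \sw_(x1G ⊗ x'1G <- G (x1 ⊗ x'1)) x1G ⊗ x'1G ⊗ τ (x2 ⊗ x'2).

Fact hprod_linear : linear hprod.
Proof. rewrite /hprod; multilinear. Qed.

HB.instance Definition _ :=
  GRing.isLinear.Build K _ M *:%R hprod hprod_linear.

Lemma hprodE x x' : hprod (x ⊗ x') =
  \sw_(x1 ⊗ x2 <- Δ x) \sw_(x'1 ⊗ x'2 <- Δ x')
  \sw_(x1G ⊗ x'1G <- G (x1 ⊗ x'1)) x1G ⊗ x'1G ⊗ τ (x2 ⊗ x'2).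
Proof. by rewrite /hprod; sw_pure. Qed.

Lemma linear_hprod (U : lmodType K) (h : M -> U) x x' : linear h ->
  h (hprod (x ⊗ x')) =
  \sw_(x1 ⊗ x2 <- Δ x) \sw_(x'1 ⊗ x'2 <- Δ x')
  \sw_(x1G ⊗ x'1G <- G (x1 ⊗ x'1)) h (x1G ⊗ x'1G ⊗ τ (x2 ⊗ x'2)).
Proof.
move=> h_lin; rewrite hprodE (sw_out _ _ h_lin); apply: eq_sw => x1 x2.
by rewrite (sw_out _ _ h_lin); apply: eq_sw => x'1 x'2; rewrite (sw_out _ _ h_lin).
Qed.

Lemma biact_hprod a x x' b : biact (a ⊗ hprod (x ⊗ x') ⊗ b) =
  \sw_(x1 ⊗ x2 <- Δ x) \sw_(x'1 ⊗ x'2 <- Δ x')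
  \sw_(x1G ⊗ x'1G <- G (x1 ⊗ x'1)) a ∙ x1G ⊗ x'1G ⊗ τ (x2 ⊗ x'2) ∙ b.
Proof.
rewrite (linear_hprod (h := fun m => biact (a ⊗ m ⊗ b))); last by multilinear.
by apply: eq_sw => ? ?; apply: eq_sw => ? ?; apply: eq_sw => ? ?; rewrite biactE.
Qed.

(** R and T bring the two inner factors a' and b to the outside; what is left
    in the middle is a product of two elements of H. *)
Lemma mulE a x b a' x' b' : (a ⊗ x ⊗ b) ⋆ (a' ⊗ x' ⊗ b') =
  \sw_(a'R ⊗ xR <- R (x ⊗ a')) \sw_(x'T ⊗ bT <- T (b ⊗ x'))
    biact (a ∙ a'R ⊗ hprod (xR ⊗ x'T) ⊗ bT ∙ b').
Proof.
rewrite mul_bt bt_mulE; apply: eq_sw => a'R xR; apply: eq_sw => xT bT.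
rewrite biact_hprod.
by apply: eq_sw => ? ?; apply: eq_sw => ? ?; apply: eq_sw => ? ?; rewrite !amulA.
Qed.

Lemma biact_mul a u v b :
  biact (a ⊗ (u ⋆ v) ⊗ b) = biact (a ⊗ u ⊗ aone B) ⋆ biact (aone A ⊗ v ⊗ b).
Proof.
move: u; apply: triple_ext => [||a1 x1 b1]; try by multilinear.
move: v; apply: triple_ext => [||a2 x2 b2]; try by multilinear.
rewrite !biactE !mulE amul1l amul1r.
rewrite (sw_out (h := fun m => biact (a ⊗ m ⊗ b))); last by multilinear.
apply: eq_sw => a2R x1R.
rewrite (sw_out (h := fun m => biact (a ⊗ m ⊗ b))); last by multilinear.
apply: eq_sw => x2T b1T.
by rewrite biact_biact !amulA.
Qed.

(** * Unit and nuclei *)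

Variable oneH : H.
Hypothesis oneH_grouplike : Δ oneH = oneH ⊗ oneH.
Hypothesis LB1l : forall a : A, R (oneH ⊗ a) = a ⊗ oneH.
Hypothesis LB1r : forall x : H, R (x ⊗ aone A) = aone A ⊗ x.
Hypothesis LB2 : forall (a a' : A) (x : H),
  R (x ⊗ a ∙ a') =
  \sw_(aR ⊗ xR <- R (x ⊗ a)) \sw_(a'r ⊗ xRr <- R (xR ⊗ a'))
    aR ∙ a'r ⊗ xRr.
Hypothesis LB3l : forall x : H, G (x ⊗ oneH) = aone A ⊗ x.
Hypothesis LB3r : forall x : H, G (oneH ⊗ x) = aone A ⊗ x.
Hypothesis RB1l : forall b : B, T (b ⊗ oneH) = oneH ⊗ b.
Hypothesis RB1r : forall x : H, T (aone B ⊗ x) = x ⊗ aone B.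
Hypothesis RB2 : forall (x : H) (b b' : B),
  T (b ∙ b' ⊗ x) =
  \sw_(xT ⊗ b'T <- T (b' ⊗ x)) \sw_(xTt ⊗ bt <- T (b ⊗ xT))
    xTt ⊗ bt ∙ b'T.
Hypothesis RTC2l : forall x : H, τ (x ⊗ oneH) = ε x *: aone B.
Hypothesis RTC2r : forall x : H, τ (oneH ⊗ x) = ε x *: aone B.

Local Notation iA a := (a ⊗ oneH ⊗ aone B).
Local Notation iH x := (aone A ⊗ x ⊗ aone B).
Local Notation iB b := (aone A ⊗ oneH ⊗ b).

(** As 1 is grouplike, only x is split; the values of G and τ at 1 leave
    x1 ⊗ ε(x2), which counitality contracts to x. *)
Lemma hprod1r x : hprod (x ⊗ oneH) = iH x.
Proof.
rewrite hprodE oneH_grouplike.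
have [_ _ counitr] := coalgebraP (s := H).
rewrite -[in RHS](counitr x) (sw_out (h := fun y => iH y)); last by multilinear.
apply: eq_sw => x1 x2; sw_pure; rewrite LB3l; sw_pure.
by rewrite RTC2l !(tensZr, tensZl).
Qed.

Lemma hprod1l x : hprod (oneH ⊗ x) = iH x.
Proof.
have [_ _ counitr] := coalgebraP (s := H).
rewrite hprodE oneH_grouplike; sw_pure.
rewrite -[in RHS](counitr x) (sw_out (h := fun y => iH y)); last by multilinear.
apply: eq_sw => x1 x2; rewrite LB3r; sw_pure.
by rewrite RTC2r !(tensZr, tensZl).
Qed.

Lemma mulA_l a v : iA a ⋆ v = biact (a ⊗ v ⊗ aone B).
Proof.
move: v; apply: triple_ext => [||a' x b]; try by multilinear.
rewrite mulE LB1l; sw_pure; rewrite RB1r; sw_pure.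
by rewrite hprod1l !biactE !amul1r !amul1l.
Qed.

Lemma mulB_r v b : v ⋆ iB b = biact (aone A ⊗ v ⊗ b).
Proof.
move: v; apply: triple_ext => [||a x b']; try by multilinear.
rewrite mulE LB1r; sw_pure; rewrite RB1l; sw_pure.
by rewrite hprod1r !biactE !amul1r !amul1l.
Qed.

Lemma mulA_r a x b a' : (a ⊗ x ⊗ b) ⋆ iA a' =
  \sw_(a'R ⊗ xR <- R (x ⊗ a')) a ∙ a'R ⊗ xR ⊗ b.
Proof.
rewrite mulE; apply: eq_sw => a'R xR; rewrite RB1l; sw_pure.
by rewrite hprod1r !biactE !amul1l !amul1r.
Qed.

Lemma mulB_l b a x b' : iB b ⋆ (a ⊗ x ⊗ b') =
  \sw_(xT ⊗ bT <- T (b ⊗ x)) a ⊗ xT ⊗ bT ∙ b'.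
Proof.
rewrite mulE LB1l; sw_pure; apply: eq_sw => a'R xR.
by rewrite hprod1l !biactE !amul1l !amul1r.
Qed.

(** Multiplying by A on the left, or by B on the right, is the outer action,
    which passes through ⋆ by [biact_mul]. *)
Lemma nucleusA_l a u v : iA a ⋆ (u ⋆ v) = iA a ⋆ u ⋆ v.
Proof. by rewrite !mulA_l biact_mul biact1. Qed.

Lemma nucleusB_r u v b : u ⋆ (v ⋆ iB b) = u ⋆ v ⋆ iB b.
Proof. by rewrite !mulB_r biact_mul biact1. Qed.

(** By [LB2], a product of two elements of A crosses x in one step as it does one
    factor at a time. *)
Lemma nucleusA_m u a v : u ⋆ (iA a ⋆ v) = u ⋆ iA a ⋆ v.
Proof.
move: u; apply: triple_ext => [||a1 x1 b1]; try by multilinear.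
move: v; apply: triple_ext => [||a2 x2 b2]; try by multilinear.
rewrite mulA_l biactE amul1r mulE LB2 sw_sw; last by multilinear.
rewrite mulA_r (sw_out (h := fun m => m ⋆ _)); last by multilinear.
apply: eq_sw => aR xR; rewrite sw_sw; last by multilinear.
rewrite mulE; apply: eq_sw => ? ?; sw_pure.
by apply: eq_sw => ? ?; rewrite !amulA.
Qed.

(** The mirror image, by [RB2]; here the two sides list the sums over R and T in
    opposite orders. *)
Lemma nucleusB_m u b v : u ⋆ (iB b ⋆ v) = u ⋆ iB b ⋆ v.
Proof.
move: u; apply: triple_ext => [||a1 x1 b1]; try by multilinear.
move: v; apply: triple_ext => [||a2 x2 b2]; try by multilinear.
rewrite mulB_r biactE amul1l mulB_l [RHS]mulE RB2.
rewrite (sw_out (h := fun m => _ ⋆ m)); last by multilinear.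
transitivity (\sw_(xT ⊗ bT <- T (b ⊗ x2)) \sw_(aR ⊗ xR <- R (x1 ⊗ a2))
   \sw_(xTt ⊗ bt <- T (b1 ⊗ xT)) biact (a1 ∙ aR ⊗ hprod (xR ⊗ xTt) ⊗ bt ∙ bT ∙ b2)).
  apply: eq_sw => xT bT; rewrite mulE; apply: eq_sw => ? ?.
  by apply: eq_sw => ? ?; rewrite !amulA.
rewrite sw_swap; apply: eq_sw => aR xR; rewrite sw_sw; last by multilinear.
apply: eq_sw => xT bT; rewrite sw_sw; last by multilinear.
by apply: eq_sw => ? ?; sw_pure.
Qed.

Lemma mul_unitl u : iA (aone A) ⋆ u = u.
Proof. by rewrite mulA_l biact1. Qed.

Lemma mul_unitr u : u ⋆ iA (aone A) = u.
Proof. by rewrite mulB_r biact1. Qed.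

(** * Generators *)

Lemma mulHH x x' : iH x ⋆ iH x' = hprod (x ⊗ x').
Proof. by rewrite mulE LB1r; sw_pure; rewrite RB1r; sw_pure; rewrite !amul1l biact1. Qed.

Lemma pure_split a x b : a ⊗ x ⊗ b = iA a ⋆ (iH x ⋆ iB b).
Proof. by rewrite mulB_r biactE mulA_l biactE !amul1r !amul1l. Qed.

Lemma mulBH b x : iB b ⋆ iH x = \sw_(xT ⊗ bT <- T (b ⊗ x)) iH xT ⋆ iB bT.
Proof.
rewrite mulB_l; apply: eq_sw => xT bT.
by rewrite mulB_r biactE !amul1l !amul1r.
Qed.

Lemma mulBA b a : iB b ⋆ iA a = iA a ⋆ iB b.
Proof. by rewrite mulA_l mulA_r biactE LB1l; sw_pure; rewrite !amul1l !amul1r. Qed.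

(** * Reduction to four kinds of triples *)

Definition associates u v w := u ⋆ (v ⋆ w) = u ⋆ v ⋆ w.

Lemma associates_sw_l (V W : lmodType K) (f : V -> W -> M) t v w :
  (forall p q, associates (f p q) v w) -> associates (\sw_(p ⊗ q <- t) f p q) v w.
Proof.
move=> fP; rewrite /associates.
rewrite (sw_out (h := fun u => u ⋆ (v ⋆ w))); last by multilinear.
rewrite (sw_out (h := fun u => u ⋆ v ⋆ w)); last by multilinear.
by apply: eq_sw.
Qed.

Lemma associates_sw_m (V W : lmodType K) (f : V -> W -> M) t u w :
  (forall p q, associates u (f p q) w) -> associates u (\sw_(p ⊗ q <- t) f p q) w.
Proof.
move=> fP; rewrite /associates.
rewrite (sw_out (h := fun v => u ⋆ (v ⋆ w))); last by multilinear.
rewrite (sw_out (h := fun v => u ⋆ v ⋆ w)); last by multilinear.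
by apply: eq_sw.
Qed.

Lemma associates_sw_r (V W : lmodType K) (f : V -> W -> M) t u v :
  (forall p q, associates u v (f p q)) -> associates u v (\sw_(p ⊗ q <- t) f p q).
Proof.
move=> fP; rewrite /associates.
rewrite (sw_out (h := fun w => u ⋆ (v ⋆ w))); last by multilinear.
rewrite (sw_out (h := fun w => u ⋆ v ⋆ w)); last by multilinear.
by apply: eq_sw.
Qed.

(** The next six lemmas are instances of the Teichmüller identity
    u(v,w,z) + (u,v,w)z = (uv,w,z) - (u,vw,z) + (u,v,wz) for the associator, with the
    terms that have a nuclear entry deleted. *)
Lemma associates_mB u v b w : associates u v (iB b ⋆ w) -> associates u (v ⋆ iB b) w.
Proof. by rewrite /associates nucleusB_r -!nucleusB_m => ->. Qed.

Lemma associates_lA a u v w : associates u v w -> associates (iA a ⋆ u) v w.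
Proof. by rewrite /associates -!nucleusA_l => ->. Qed.

Lemma associates_rB u v w b : associates u v w -> associates u v (w ⋆ iB b).
Proof. by rewrite /associates !nucleusB_r => ->. Qed.

Lemma associates_mA u a v w : associates (u ⋆ iA a) v w -> associates u (iA a ⋆ v) w.
Proof. by rewrite /associates -nucleusA_l !nucleusA_m => ->. Qed.

Lemma associates_lB u b v w :
  associates (iB b) v w -> associates u (iB b ⋆ v) w -> associates (u ⋆ iB b) v w.
Proof. by rewrite /associates -!nucleusB_m => -> ->. Qed.

Lemma associates_rA u v a w :
  associates u v (iA a) -> associates u (v ⋆ iA a) w -> associates u v (iA a ⋆ w).
Proof. by rewrite /associates !nucleusA_m => <- ->. Qed.

(** The possible right ends of a reduced triple; [associates_mulB_HA] treats both
    at once, since an element of B can be moved to the right past either. *)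
Inductive HA : M -> Prop := HA_H x : HA (iH x) | HA_A a : HA (iA a).

Lemma associates_mulB_HA b w u v : (forall w, HA w -> associates u v w) -> HA w ->
  associates u v (iB b ⋆ w).
Proof.
move=> uv [x|a].
  by rewrite mulBH; apply: associates_sw_r => p q; apply/associates_rB/uv; constructor.
by rewrite mulBA; apply/associates_rB/uv; constructor.
Qed.

Section Reduction.

Hypothesis HHH : forall x x' x'', associates (iH x) (iH x') (iH x'').
Hypothesis HHA : forall x x' a, associates (iH x) (iH x') (iA a).
Hypothesis BHH : forall b x x', associates (iB b) (iH x) (iH x').
Hypothesis BHA : forall b x a, associates (iB b) (iH x) (iA a).

(** Write u = a ⋆ (y ⋆ b): a factors out on the left, and b is moved through x and w
    until it factors out on the right; (y, _, w) and (b, x, w) remain. *)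
Lemma associates_H_HA u x w : HA w -> associates u (iH x) w.
Proof.
move=> wHA; move: u.
have HH y z : forall w, HA w -> associates (iH y) (iH z) w by move=> _ [].
apply: triple_ext => [||a y b]; try by multilinear.
rewrite pure_split; apply: associates_lA; apply: associates_lB; first by case: wHA.
rewrite mulBH; apply: associates_sw_m => p q; apply: associates_mB.
by apply: associates_mulB_HA => //; exact: HH.
Qed.

(** Write v = a ⋆ (y ⋆ b): a is absorbed into u, which is arbitrary by
    [associates_H_HA], and b is moved past w. *)
Lemma associates_HA u v w : HA w -> associates u v w.
Proof.
move=> wHA; move: v; apply: triple_ext => [||a y b]; try by multilinear.
rewrite pure_split; apply: associates_mA; apply: associates_mB.
apply: associates_mulB_HA => // ? ?; exact: associates_H_HA.
Qed.

(** Write w = a ⋆ (y ⋆ b): b factors out, and (u, v, a ⋆ y) splits into triples ending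
    in a and in y. *)
Lemma associates_all u v w : associates u v w.
Proof.
move: w; apply: triple_ext => [||a y b]; try by multilinear.
rewrite pure_split nucleusB_r; apply: associates_rB.
by apply: associates_rA; apply: associates_HA; constructor.
Qed.

End Reduction.

Lemma is_algebra_associates :
  is_algebra (bt_mul G R T τ) (aone A ⊗ oneH ⊗ aone B) <->
  [/\ forall x x' x'', associates (iH x) (iH x') (iH x''),
      forall x x' a, associates (iH x) (iH x') (iA a),
      forall b x x', associates (iB b) (iH x) (iH x') &
      forall b x a, associates (iB b) (iH x) (iA a)].
Proof.
split=> [[_ bt_mulA _ _]|[HHH HHA BHH BHA]].
  by split=> *; rewrite /associates !mul_bt bt_mulA.
split; [exact: bt_mul_bilinear | | |] => [u v w|u|u]; rewrite -!mul_bt.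
- exact: associates_all.
- exact: mul_unitl.
- exact: mul_unitr.
Qed.

(** * The two bracketings of the four triples *)

Lemma mulHH_H x x' x'' : iH x ⋆ iH x' ⋆ iH x'' =
  \sw_(x1 ⊗ x2 <- Δ x) \sw_(x'1 ⊗ x'2 <- Δ x')
  \sw_(x1G ⊗ x'1G <- G (x1 ⊗ x'1))
  \sw_(x'1G1 ⊗ x'1G2 <- Δ x'1G)
  \sw_(x''T ⊗ τT <- T (τ (x2 ⊗ x'2) ⊗ x''))
  \sw_(x''T1 ⊗ x''T2 <- Δ x''T)
  \sw_(x'1G1g ⊗ x''T1g <- G (x'1G1 ⊗ x''T1))
    x1G ∙ x'1G1g ⊗ x''T1g ⊗ τ (x'1G2 ⊗ x''T2) ∙ τT.
Proof.
rewrite mulHH (linear_hprod (h := fun m => m ⋆ iH x'')); last by multilinear.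
apply: eq_sw => x1 x2; apply: eq_sw => x'1 x'2.
apply: eq_sw => x1G x'1G; rewrite mulE LB1r; sw_pure.
rewrite [RHS]sw_swap; apply: eq_sw => x''T τT.
by rewrite biact_hprod amul1r amul1r.
Qed.

Lemma mulH_HH x x' x'' : iH x ⋆ (iH x' ⋆ iH x'') =
  \sw_(x'1 ⊗ x'2 <- Δ x') \sw_(x''1 ⊗ x''2 <- Δ x'')
  \sw_(x'1G ⊗ x''1G <- G (x'1 ⊗ x''1))
  \sw_(x'1GR ⊗ xR <- R (x ⊗ x'1G))
  \sw_(xR1 ⊗ xR2 <- Δ xR)
  \sw_(x''1G1 ⊗ x''1G2 <- Δ x''1G)
  \sw_(xR1g ⊗ x''1G1g <- G (xR1 ⊗ x''1G1))
    x'1GR ∙ xR1g ⊗ x''1G1g ⊗ τ (xR2 ⊗ x''1G2) ∙ τ (x'2 ⊗ x''2).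
Proof.
rewrite mulHH (linear_hprod (h := fun m => iH x ⋆ m)); last by multilinear.
apply: eq_sw => x'1 x'2; apply: eq_sw => x''1 x''2.
apply: eq_sw => x'1G x''1G; rewrite mulE; apply: eq_sw => x'1GR xR.
by rewrite RB1r; sw_pure; rewrite biact_hprod !amul1l.
Qed.

Lemma mulH_HA a x x' : iH x ⋆ (iH x' ⋆ iA a) =
  \sw_(aR ⊗ x'R <- R (x' ⊗ a)) \sw_(aRr ⊗ xr <- R (x ⊗ aR))
  \sw_(xr1 ⊗ xr2 <- Δ xr) \sw_(x'R1 ⊗ x'R2 <- Δ x'R)
  \sw_(xr1G ⊗ x'R1G <- G (xr1 ⊗ x'R1))
    aRr ∙ xr1G ⊗ x'R1G ⊗ τ (xr2 ⊗ x'R2).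
Proof.
rewrite mulA_r (sw_out (h := fun m => iH x ⋆ m)); last by multilinear.
apply: eq_sw => aR x'R; rewrite amul1l mulE; apply: eq_sw => aRr xr.
rewrite RB1r; sw_pure; rewrite biact_hprod.
apply: eq_sw => ? ?; apply: eq_sw => ? ?; apply: eq_sw => ? ?.
by rewrite !amul1l !amul1r.
Qed.

Lemma mulHH_A a x x' : iH x ⋆ iH x' ⋆ iA a =
  \sw_(x1 ⊗ x2 <- Δ x) \sw_(x'1 ⊗ x'2 <- Δ x')
  \sw_(x1G ⊗ x'1G <- G (x1 ⊗ x'1))
  \sw_(aR ⊗ x'1GR <- R (x'1G ⊗ a))
    x1G ∙ aR ⊗ x'1GR ⊗ τ (x2 ⊗ x'2).
Proof.
rewrite mulHH (linear_hprod (h := fun m => m ⋆ iA a)); last by multilinear.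
apply: eq_sw => x1 x2; apply: eq_sw => x'1 x'2.
by apply: eq_sw => x1G x'1G; rewrite mulA_r.
Qed.

Lemma mulB_HH b x x' : iB b ⋆ (iH x ⋆ iH x') =
  \sw_(x1 ⊗ x2 <- Δ x) \sw_(x'1 ⊗ x'2 <- Δ x')
  \sw_(x1G ⊗ x'1G <- G (x1 ⊗ x'1))
  \sw_(x'1GT ⊗ bT <- T (b ⊗ x'1G))
    x1G ⊗ x'1GT ⊗ bT ∙ τ (x2 ⊗ x'2).
Proof.
rewrite mulHH (linear_hprod (h := fun m => iB b ⋆ m)); last by multilinear.
apply: eq_sw => x1 x2; apply: eq_sw => x'1 x'2.
by apply: eq_sw => x1G x'1G; rewrite mulB_l.
Qed.

Lemma mulBH_H b x x' : iB b ⋆ iH x ⋆ iH x' =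
  \sw_(xT ⊗ bT <- T (b ⊗ x)) \sw_(x't ⊗ bTt <- T (bT ⊗ x'))
  \sw_(xT1 ⊗ xT2 <- Δ xT) \sw_(x't1 ⊗ x't2 <- Δ x't)
  \sw_(xT1G ⊗ x't1G <- G (xT1 ⊗ x't1))
    xT1G ⊗ x't1G ⊗ τ (xT2 ⊗ x't2) ∙ bTt.
Proof.
rewrite mulB_l (sw_out (h := fun m => m ⋆ iH x')); last by multilinear.
apply: eq_sw => xT bT; rewrite amul1r mulE LB1r; sw_pure.
apply: eq_sw => x't bTt; rewrite biact_hprod.
apply: eq_sw => ? ?; apply: eq_sw => ? ?; apply: eq_sw => ? ?.
by rewrite !amul1l !amul1r.
Qed.

Lemma mulB_HA a x b : iB b ⋆ (iH x ⋆ iA a) =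
  \sw_(aR ⊗ xR <- R (x ⊗ a)) \sw_(xRT ⊗ bT <- T (b ⊗ xR))
    aR ⊗ xRT ⊗ bT.
Proof.
rewrite mulA_r (sw_out (h := fun m => iB b ⋆ m)); last by multilinear.
apply: eq_sw => aR xR; rewrite mulB_l.
by apply: eq_sw => ? ?; rewrite amul1l amul1r.
Qed.

Lemma mulBH_A a x b : iB b ⋆ iH x ⋆ iA a =
  \sw_(xT ⊗ bT <- T (b ⊗ x)) \sw_(aR ⊗ xTR <- R (xT ⊗ a))
    aR ⊗ xTR ⊗ bT.
Proof.
rewrite mulB_l (sw_out (h := fun m => m ⋆ iA a)); last by multilinear.
apply: eq_sw => xT bT; rewrite mulA_r.
by apply: eq_sw => ? ?; rewrite amul1l amul1r.
Qed.

End BTAlgebra.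

Theorem theorem2p3 (K : fieldType) (H : coalgType K) (oneH : H)
    (A B : assocAlgType K)
    (G : {linear H ⊗[K] H -> A ⊗[K] H}) (R : {linear H ⊗[K] A -> A ⊗[K] H})
    (T : {linear B ⊗[K] H -> H ⊗[K] B}) (τ : {linear H ⊗[K] H -> B})
    (oneH_grouplike : Δ oneH = oneH ⊗ oneH)
    (LB1l : forall a : A, R (oneH ⊗ a) = a ⊗ oneH)
    (LB1r : forall x : H, R (x ⊗ aone A) = aone A ⊗ x)
    (LB2 : forall (a a' : A) (x : H),
      R (x ⊗ a ∙ a') =
      \sw_(aR ⊗ xR <- R (x ⊗ a)) \sw_(a'r ⊗ xRr <- R (xR ⊗ a'))
        aR ∙ a'r ⊗ xRr)
    (LB3l : forall x : H, G (x ⊗ oneH) = aone A ⊗ x)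
    (LB3r : forall x : H, G (oneH ⊗ x) = aone A ⊗ x)
    (RB1l : forall b : B, T (b ⊗ oneH) = oneH ⊗ b)
    (RB1r : forall x : H, T (aone B ⊗ x) = x ⊗ aone B)
    (RB2 : forall (x : H) (b b' : B),
      T (b ∙ b' ⊗ x) =
      \sw_(xT ⊗ b'T <- T (b' ⊗ x)) \sw_(xTt ⊗ bt <- T (b ⊗ xT))
        xTt ⊗ bt ∙ b'T)
    (RTC2l : forall x : H, τ (x ⊗ oneH) = ε x *: aone B)
    (RTC2r : forall x : H, τ (oneH ⊗ x) = ε x *: aone B) :
  is_algebra (bt_mul G R T τ) (aone A ⊗ oneH ⊗ aone B) <->
  [/\ (* BT1 *)
      forall x x' x'' : H,
        \sw_(x1 ⊗ x2 <- Δ x) \sw_(x'1 ⊗ x'2 <- Δ x')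
        \sw_(x1G ⊗ x'1G <- G (x1 ⊗ x'1))
        \sw_(x'1G1 ⊗ x'1G2 <- Δ x'1G)
        \sw_(x''T ⊗ τT <- T (τ (x2 ⊗ x'2) ⊗ x''))
        \sw_(x''T1 ⊗ x''T2 <- Δ x''T)
        \sw_(x'1G1g ⊗ x''T1g <- G (x'1G1 ⊗ x''T1))
          x1G ∙ x'1G1g ⊗ x''T1g ⊗ τ (x'1G2 ⊗ x''T2) ∙ τT
        =
        \sw_(x'1 ⊗ x'2 <- Δ x') \sw_(x''1 ⊗ x''2 <- Δ x'')
        \sw_(x'1G ⊗ x''1G <- G (x'1 ⊗ x''1))
        \sw_(x'1GR ⊗ xR <- R (x ⊗ x'1G))
        \sw_(xR1 ⊗ xR2 <- Δ xR)
        \sw_(x''1G1 ⊗ x''1G2 <- Δ x''1G)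
        \sw_(xR1g ⊗ x''1G1g <- G (xR1 ⊗ x''1G1))
          x'1GR ∙ xR1g ⊗ x''1G1g ⊗ τ (xR2 ⊗ x''1G2) ∙ τ (x'2 ⊗ x''2),
      (* BT2 *)
      forall (a : A) (x x' : H),
        \sw_(aR ⊗ x'R <- R (x' ⊗ a)) \sw_(aRr ⊗ xr <- R (x ⊗ aR))
        \sw_(xr1 ⊗ xr2 <- Δ xr) \sw_(x'R1 ⊗ x'R2 <- Δ x'R)
        \sw_(xr1G ⊗ x'R1G <- G (xr1 ⊗ x'R1))
          aRr ∙ xr1G ⊗ x'R1G ⊗ τ (xr2 ⊗ x'R2)
        =
        \sw_(x1 ⊗ x2 <- Δ x) \sw_(x'1 ⊗ x'2 <- Δ x')
        \sw_(x1G ⊗ x'1G <- G (x1 ⊗ x'1))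
        \sw_(aR ⊗ x'1GR <- R (x'1G ⊗ a))
          x1G ∙ aR ⊗ x'1GR ⊗ τ (x2 ⊗ x'2),
      (* BT3 *)
      forall (x x' : H) (b : B),
        \sw_(x1 ⊗ x2 <- Δ x) \sw_(x'1 ⊗ x'2 <- Δ x')
        \sw_(x1G ⊗ x'1G <- G (x1 ⊗ x'1))
        \sw_(x'1GT ⊗ bT <- T (b ⊗ x'1G))
          x1G ⊗ x'1GT ⊗ bT ∙ τ (x2 ⊗ x'2)
        =
        \sw_(xT ⊗ bT <- T (b ⊗ x)) \sw_(x't ⊗ bTt <- T (bT ⊗ x'))
        \sw_(xT1 ⊗ xT2 <- Δ xT) \sw_(x't1 ⊗ x't2 <- Δ x't)
        \sw_(xT1G ⊗ x't1G <- G (xT1 ⊗ x't1))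
          xT1G ⊗ x't1G ⊗ τ (xT2 ⊗ x't2) ∙ bTt
    & (* BT4 *)
      forall (a : A) (x : H) (b : B),
        \sw_(aR ⊗ xR <- R (x ⊗ a)) \sw_(xRT ⊗ bT <- T (b ⊗ xR))
          aR ⊗ xRT ⊗ bT
        =
        \sw_(xT ⊗ bT <- T (b ⊗ x)) \sw_(aR ⊗ xTR <- R (xT ⊗ a))
          aR ⊗ xTR ⊗ bT].
Proof.
have [to_triples of_triples] := is_algebra_associates oneH_grouplike LB1l LB1r LB2
  LB3l LB3r RB1l RB1r RB2 RTC2l RTC2r.
split=> [/to_triples[HHH HHA BHH BHA]|[BT1 BT2 BT3 BT4]].
  split.
  - move=> x x' x''; have := HHH x x' x''.
    by rewrite /associates mulH_HH // mulHH_H.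
  - by move=> a x x'; have := HHA x x' a; rewrite /associates mulH_HA // mulHH_A.
  - by move=> x x' b; have := BHH b x x'; rewrite /associates mulB_HH // mulBH_H.
  - by move=> a x b; have := BHA b x a; rewrite /associates mulB_HA // mulBH_A.
apply: of_triples; split.
- by move=> x x' x''; rewrite /associates mulH_HH // mulHH_H // BT1.
- by move=> x x' a; rewrite /associates mulH_HA // mulHH_A // BT2.
- by move=> b x x'; rewrite /associates mulB_HH // mulBH_H // BT3.
- by move=> b x a; rewrite /associates mulB_HA // mulBH_A // BT4.
Qed.
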